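(* Let $n$ be a positive integer, let $q$ be a prime power, and let $\mathcal{M}_n(\mathbb{F}_q)$ be the ring of $n \times n$ matrices over the finite field $\mathbb{F}_q$. Then $\mu_1(\mathcal{M}_n(\mathbb{F}_q))$ equals the exponent of the group $\mathrm{GL}(n, \mathbb{F}_q)$, and $\mu_0(\mathcal{M}_n(\mathbb{F}_q)) = n$.
   Context: For a ring $R$, the exponential period $\mu_1(R)$ is the smallest positive integer $r$ such that for each $x \in R$ there is a positive integer $m(x)$ with $x^{m(x)+r} = x^{m(x)}$. The onset of exponential periodicity is $\mu_0(R) = \max_{x \in R} \min\{m \in \mathbb{N} : x^{m+\mu_1} = x^m\}$, where $\mathbb{N}$ is the set of positive integers. *)

(* Defs.v *)
From HB Require Import structures.
From mathcomp Require Import all_boot all_order all_algebra.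
From mathcomp Require Import all_fingroup all_solvable.

Set Implicit Arguments.
Unset Strict Implicit.
Unset Printing Implicit Defensive.

Import GRing.Theory.

Local Open Scope ring_scope.

(* An arbitrary ring need not have an exponential period, and the onset may be
   undefined, so "mu_1(R) = r" and "mu_0(R) = k" are stated as relations; they
   assert existence of the minimum or maximum and determine its value
   ([is_mu1_unique], [is_mu0_unique]). The structure [pzRingType] is used since
   'M[F]_n carries it for every n. *)

Definition uniform_period (R : pzRingType) (r : nat) : Prop :=
  (0 < r)%N /\
  forall x : R, exists m : nat, (0 < m)%N /\ x ^+ (m + r) = x ^+ m.

Definition is_mu1 (R : pzRingType) (r : nat) : Prop :=
  uniform_period R r /\ forall s : nat, uniform_period R s -> (r <= s)%N.

(* m = min {m in N : x^(m+r) = x^m}, where N excludes 0. *)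
Definition is_onset_at (R : pzRingType) (r : nat) (x : R) (m : nat) : Prop :=
  [/\ (0 < m)%N, x ^+ (m + r) = x ^+ m &
      forall l : nat, (0 < l)%N -> x ^+ (l + r) = x ^+ l -> (m <= l)%N].

Definition is_mu0 (R : pzRingType) (k : nat) : Prop :=
  exists r : nat,
    [/\ is_mu1 R r,
        exists x : R, is_onset_at r x k &
        forall (x : R) (m : nat), is_onset_at r x m -> (m <= k)%N].

Lemma is_mu1_unique (R : pzRingType) (r s : nat) :
  is_mu1 R r -> is_mu1 R s -> r = s.
Proof.
move=> [rP r_min] [sP s_min]; apply/eqP.
by rewrite eqn_leq r_min ?s_min.
Qed.

Lemma is_mu0_unique (R : pzRingType) (k l : nat) :
  is_mu0 R k -> is_mu0 R l -> k = l.
Proof.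
move=> [r [r1 [x xk] k_max]] [s [s1 [y yl] l_max]].
have rs := is_mu1_unique r1 s1; subst s; apply/eqP.
by rewrite eqn_leq (l_max x) ?(k_max y).
Qed.

(* Main.v *)
Require Import Defs.
From HB Require Import structures.
From mathcomp Require Import all_boot all_order all_algebra.
From mathcomp Require Import all_fingroup all_solvable.

Set Implicit Arguments.
Unset Strict Implicit.
Unset Printing Implicit Defensive.

(** Write e for the exponent of GL_n(F). Everything follows from the identity
    [A ^+ (n + e) = A ^+ n], valid for every matrix A. To prove it, let
    [P = A ^+ m] be an idempotent power of A ([exists_idempotent_power]), which
    gives the Fitting decomposition of A: on the image of P the matrix A is
    invertible, on the image of [1 - P] it is nilpotent.
    - The matrix [A * P + (1 - P)] acts as A on the first summand and as the
      identity on the second, so it is a unit ([fitting_unit]). Its e-th power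
      is 1, and hence [A ^+ e * P = P].
    - The matrix [A * (1 - P)] is nilpotent of size n, so its n-th power is 0
      ([nilpotent_mx_expr]), and hence [A ^+ n = A ^+ n * P].

    No smaller period is possible: an eventual period of a unit is a true
    period, so a uniform period is a multiple of the exponent of the group of
    units. The onset n is attained by a full nilpotent Jordan block, since the
    powers of a nilpotent element become periodic only once they vanish. *)

Section Powers.

Import GRing.Theory.
Local Open Scope ring_scope.

Lemma expr_idem (R : pzRingType) (p : R) (k : nat) :
  p * p = p -> p ^+ k.+1 = p.
Proof. by move=> pp; elim: k => [|k IHk]; rewrite ?expr1 // exprS IHk. Qed.

Lemma idem_compl (R : pzRingType) (p : R) :
  p * p = p -> (1 - p) * (1 - p) = 1 - p.
Proof. by move=> pp; rewrite mulrBl mul1r mulrBr mulr1 pp subrr subr0. Qed.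

Lemma eventual_period_mul (R : pzRingType) (x : R) (m r k : nat) :
  x ^+ (m + r) = x ^+ m -> x ^+ (m + r * k) = x ^+ m.
Proof.
move=> xmr; elim: k => [|k IHk]; first by rewrite muln0 addn0.
by rewrite mulnS addnA exprD xmr -exprD.
Qed.

(** If [x ^+ (i + d) = x ^+ i] with d positive, then every positive multiple
    of d that is at least i is the exponent of an idempotent power. *)
Lemma exists_idempotent_power (R : finNzRingType) (x : R) :
  exists m : nat, x ^+ m.+1 * x ^+ m.+1 = x ^+ m.+1.
Proof.
have [i [d xid]] : exists i d : nat, x ^+ (i + d.+1) = x ^+ i.
  have /injectivePn[i [j neq_ij xij]] :
      ~~ injectiveb (fun i : 'I_#|R|.+1 => x ^+ i).
    by apply/injectiveP => /leq_card; rewrite card_ord ltnn.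
  wlog lt_ij : i j neq_ij xij / (i < j)%N.
    move=> IH; case: (ltngtP i j) => [||/val_inj eq_ij]; first exact: IH.
      by apply: IH => //; rewrite eq_sym.
    by rewrite eq_ij eqxx in neq_ij.
  by exists i, (j - i).-1; rewrite prednK ?subn_gt0 // subnKC // ltnW.
exists (d.+1 * i.+1).-1; rewrite prednK ?muln_gt0 //.
have le_i : (i <= d.+1 * i.+1)%N by rewrite mulSn ltnW // ltnS leq_addr.
rewrite -{1 3}(subnK le_i) !exprD -mulrA -exprD.
by rewrite eventual_period_mul.
Qed.

(** On the image of the idempotent [p = x ^+ m.+1], which acts there as 1, the
    inverse of x is [x ^+ m]; so [x ^+ m * p + (1 - p)] is the inverse. *)
Lemma fitting_unit (R : unitRingType) (x : R) (m : nat) (p := x ^+ m.+1) :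
  p * p = p -> x * p + (1 - p) \is a GRing.unit.
Proof.
move=> pp.
have qq := idem_compl pp.
have pq : p * (1 - p) = 0 by rewrite mulrBr mulr1 pp subrr.
have xp k : GRing.comm (x ^+ k) p by apply/commrX/commr_sym/commrX.
have xq k : GRing.comm (x ^+ k) (1 - p).
  by apply: commrB; [exact: commr1 | exact: xp].
have qp : (1 - p) * p = 0 by rewrite mulrBl mul1r pp subrr.
have prodE a b : x ^+ a * x ^+ b = p ->
  (x ^+ a * p + (1 - p)) * (x ^+ b * p + (1 - p)) = 1.
  have q1 : p + (1 - p) = 1 by rewrite addrC subrK.
  move: (1 - p) pq qp qq (xq b) q1 => q pq qp qq xqb q1 xab.
  rewrite mulrDl !mulrDr qq -!(mulrA _ p) pq mulr0 addr0 (mulrA p) -(xp b).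
  rewrite -(mulrA _ p p) pp (mulrA _ _ p) xab pp.
  by rewrite mulrA -xqb -mulrA qp mulr0 add0r.
apply/unitrP; exists (x ^+ m * p + (1 - p)); split.
  by have := prodE m 1%N; rewrite expr1 -exprSr; apply.
by have := prodE 1%N m; rewrite expr1 -exprS; apply.
Qed.

(** The powers of the unit [x * p + (1 - p)] agree with those of x on the image
    of p, so that an identity [u ^+ k = 1] for units passes to x there. *)
Lemma expr_fitting_unit (R : pzRingType) (x p : R) (k : nat) :
  GRing.comm x p -> p * p = p ->
  (x * p + (1 - p)) ^+ k * p = x ^+ k * p.
Proof.
move=> xp pp.
have yp : (x * p + (1 - p)) * p = x * p.
  by rewrite mulrDl mulrBl mul1r -mulrA pp subrr addr0.
elim: k => [|k IHk]; first by rewrite !expr0.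
rewrite [in RHS]exprSr -[RHS]mulrA [in RHS]xp [RHS]mulrA -IHk.
by rewrite exprSr -[LHS]mulrA yp -[RHS]mulrA -[in RHS]xp.
Qed.

End Powers.

Section Matrices.

Import GRing.Theory.
Local Open Scope ring_scope.

(** The minimal polynomial divides a power of X, so it is itself a power of X,
    and its degree is at most the size of A because it divides the
    characteristic polynomial. *)
Lemma nilpotent_mx_expr (F : fieldType) (n k : nat) (A : 'M[F]_n.+1) :
  A ^+ k = 0 -> A ^+ n.+1 = 0.
Proof.
move=> Ak0.
have hornerX j : horner_mx A (('X - 0%:P) ^+ j) = A ^+ j.
  by rewrite subr0 rmorphXn /= horner_mx_X.
have /dvdp_exp_XsubCP[j _ minA] : mxminpoly A %| ('X - 0%:P) ^+ k.
  by apply: mxminpoly_min; rewrite hornerX.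
have le_j : (j <= n.+1)%N.
  have := dvdp_leq _ (mxminpoly_dvd_char A).
  rewrite (eqp_size minA) size_exp_XsubC size_char_poly ltnS; apply.
  exact/monic_neq0/char_poly_monic.
have Aj0 : A ^+ j = 0.
  by apply/eqP; rewrite -hornerX -dvd_mxminpoly (eqp_dvdl _ minA).
by move: (exprD A (n.+1 - j) j); rewrite subnK // Aj0 mulr0.
Qed.

Definition jordan_block (R : pzSemiRingType) (n : nat) : 'M[R]_n.+1 :=
  \matrix_(i, j) (i.+1 == j)%:R.

Lemma jordan_blockX (R : pzRingType) (n k : nat) (i j : 'I_n.+1) :
  (jordan_block R n ^+ k) i j = ((i + k)%N == j)%:R.
Proof.
elim: k i j => [|k IHk] i j; first by rewrite expr0 mxE addn0.
rewrite exprS mxE; under eq_bigr => l _ do rewrite mxE IHk.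
case: (ltnP i.+1 n.+1) => [lt_i|le_n].
  rewrite (bigD1 (Ordinal lt_i)) //= eqxx mul1r big1 ?addr0 ?addnS //.
  by move=> l /negPf; rewrite -val_eqE eq_sym /= => ->; rewrite mul0r.
rewrite big1 => [|l _]; last first.
  by rewrite (gtn_eqF (leq_trans (ltn_ord l) le_n)) mul0r.
rewrite gtn_eqF // addnS -addSn.
exact: leq_trans (ltn_ord j) (leq_trans le_n (leq_addr _ _)).
Qed.

Lemma jordan_blockX_eq0 (R : nzRingType) (n k : nat) :
  (jordan_block R n ^+ k == 0) = (n < k)%N.
Proof.
apply/eqP/idP => [Jk0|lt_nk].
  rewrite ltnNge; apply/negP => le_kn.
  have /eqP := congr1 (fun B : 'M[R]_n.+1 => B ord0 (inord k)) Jk0.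
  by rewrite jordan_blockX mxE inordK ?ltnS // eqxx oner_eq0.
apply/matrixP=> i j; rewrite jordan_blockX mxE gtn_eqF //.
exact: leq_trans (ltn_ord j) (leq_trans lt_nk (leq_addl _ _)).
Qed.

Lemma unit_mx_expr_exponent (F : finFieldType) (n : nat) (A : 'M[F]_n.+1) :
  A \is a GRing.unit -> A ^+ exponent ('GL_n.+1[F])%g = 1.
Proof.
move=> uA; have := expg_exponent (in_setT (Sub A uA : {'GL_n.+1[F]})).
by move/(congr1 val); rewrite FinRing.val_unitX.
Qed.

Lemma mx_expr_exponent (F : finFieldType) (n : nat) (A : 'M[F]_n.+1) :
  A ^+ (n.+1 + exponent ('GL_n.+1[F])%g) = A ^+ n.+1.
Proof.
set e := exponent _; have [m] := exists_idempotent_power A.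
set P := A ^+ m.+1 => PP.
have AP k : GRing.comm (A ^+ k) P by apply/commrX/commr_sym/commrX.
have AQ : GRing.comm A (1 - P).
  by apply: commrB; [exact: commr1 | exact: (AP 1)].
have QQ := idem_compl PP.
have AeP : A ^+ e * P = P.
  rewrite -expr_fitting_unit //; last exact: (AP 1).
  by rewrite unit_mx_expr_exponent ?mul1r //; apply: fitting_unit.
have AnP : A ^+ n.+1 = A ^+ n.+1 * P.
  have : (A * (1 - P)) ^+ n.+1 = 0.
    apply: (@nilpotent_mx_expr _ _ m.+1).
    by rewrite exprMn_comm // (expr_idem _ QQ) mulrBr mulr1 PP subrr.
  rewrite exprMn_comm // (expr_idem _ QQ) mulrBr mulr1 => /eqP.
  by rewrite subr_eq0 => /eqP.
by rewrite exprD AnP -mulrA -(AP e) AeP.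
Qed.

(** A unit u can be cancelled in [u ^+ (m + s) = u ^+ m], so every uniform
    period is a multiple of the exponent. *)
Lemma uniform_period_exponent (F : finFieldType) (n s : nat) :
  uniform_period 'M[F]_n.+1 s -> (exponent ('GL_n.+1[F])%g <= s)%N.
Proof.
case=> s_gt0 sP; apply: dvdn_leq => //; apply/exponentP => u _.
have [m [_ ums]] := sP (val u); apply: val_inj.
rewrite FinRing.val_unitX /=.
by apply: (mulrI (unitrX m (valP u))); rewrite -exprD ums mulr1.
Qed.

End Matrices.

Theorem mainTheorem9 (n : nat) (hn : 0 < n) (q : nat)
    (hq : exists p k : nat, [/\ prime p, 0 < k & q = p ^ k])
    (F : finFieldType) (hF : #|F| = q) :
  is_mu1 'M[F]_n (exponent ('GL_n[F])%g) /\ is_mu0 'M[F]_n n.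
Proof.
case: n hn => // n _; have e_gt0 := exponent_gt0 ('GL_n.+1[F])%G.
have mu1 : is_mu1 'M[F]_n.+1 (exponent ('GL_n.+1[F])%g).
  split; last by move=> s; apply: uniform_period_exponent.
  by split=> // A; exists n.+1; rewrite mx_expr_exponent.
split=> //; exists (exponent ('GL_n.+1[F])%g); split=> //; last first.
  by move=> A m [_ _ m_min]; apply: m_min; rewrite ?mx_expr_exponent.
exists (jordan_block F n); split=> [//||l _ Jl]; first exact: mx_expr_exponent.
rewrite -(jordan_blockX_eq0 F) -(eventual_period_mul n.+1 Jl).
(* The exponent e is positive, so [l + e * n.+1] exceeds n and the power of
   the Jordan block is 0. *)
by rewrite jordan_blockX_eq0 (leq_trans (leq_pmull _ e_gt0)) ?leq_addl.
Qed.
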